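(* Let $R$ be an associative ring with unit. (I) The following conditions are equivalent: (a) $\mathrm{Findim}(R_R)<\infty$. (b) There is a hereditary complete cotorsion pair $(\mathcal A,\mathcal B)$ in $\mathrm{Mod}\,R$ such that $\mathrm{pd}_{\mathcal A}(\mathcal A)<\infty$ and $\mathrm{resdim}_{\mathcal A}(\mathcal P)<\infty$. (c) Every hereditary complete cotorsion pair $(\mathcal A,\mathcal B)$ in $\mathrm{Mod}\,R$ such that $\mathrm{pd}_{\mathcal A}(\mathcal A)<\infty$ satisfies $\mathrm{resdim}_{\mathcal A}(\mathcal P)<\infty$. (II) The following conditions are equivalent: (a) $\mathrm{findim}(R_R)<\infty$. (b) There is a hereditary complete cotorsion pair $(\mathcal A,\mathcal B)$ in $\mathrm{Mod}\,R$ such that $\mathrm{pd}_{\mathcal A}(\mathcal A)<\infty$ and $\mathrm{resdim}_{\mathcal A}(\mathcal P^{<\infty})<\infty$. (c) Every hereditary complete cotorsion pair $(\mathcal A,\mathcal B)$ in $\mathrm{Mod}\,R$ such that $\mathrm{pd}_{\mathcal A}(\mathcal A)<\infty$ satisfies $\mathrm{resdim}_{\mathcal A}(\mathcal P^{<\infty})<\infty$.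
   Context: $\mathrm{Mod}\,R$ is the category of all right $R$-modules; $\mathrm{mod}\,R$ is the full subcategory of modules possessing a projective resolution consisting of finitely generated projective modules. $\mathcal P$ is the class of all $M\in\mathrm{Mod}\,R$ with finite projective dimension, and $\mathcal P^{<\infty}=\mathcal P\cap\mathrm{mod}\,R$. $\mathrm{Findim}(R_R)=\sup\{\mathrm{pd}\,M: M\in\mathcal P\}$ and $\mathrm{findim}(R_R)=\sup\{\mathrm{pd}\,M: M\in\mathcal P^{<\infty}\}$. For a class $\mathcal X$ of modules and a module $M$, $\mathrm{pd}_{\mathcal X}(M)$ is the least $n\ge 0$ such that $\mathrm{Ext}^j_R(M,X)=0$ for all $X\in\mathcal X$ and all $j>n$ ($\infty$ if there is none); for a class $\mathcal Y$, $\mathrm{pd}_{\mathcal X}(\mathcal Y)=\sup\{\mathrm{pd}_{\mathcal X}(Y):Y\in\mathcal Y\}$. $\mathrm{resdim}_{\mathcal X}(M)$ is the least $n\ge 0$ such that there is an exact sequence $0\to X_n\to\cdots\to X_1\to X_0\to M\to 0$ with all $X_i\in\mathcal X$ ($\infty$ if there is none), and $\mathrm{resdim}_{\mathcal X}(\mathcal Y)=\sup\{\mathrm{resdim}_{\mathcal X}(Y):Y\in\mathcal Y\}$. A pair $(\mathcal A,\mathcal B)$ of classes of modules is a cotorsion pair if $\mathcal A=\{M:\mathrm{Ext}^1_R(M,B)=0\ \forall B\in\mathcal B\}$ and $\mathcal B=\{M:\mathrm{Ext}^1_R(A,M)=0\ \forall A\in\mathcal A\}$. It is complete if for every module $M$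 there are short exact sequences $0\to B\to A\to M\to 0$ and $0\to M\to B'\to A'\to 0$ with $A,A'\in\mathcal A$, $B,B'\in\mathcal B$. It is hereditary if $\mathrm{Ext}^i_R(A,B)=0$ for all $i\ge 1$, $A\in\mathcal A$, $B\in\mathcal B$. *)

(* Defs.v *)
From HB Require Import structures.
From mathcomp Require Import all_boot all_algebra boolp.
Set Implicit Arguments.
Unset Strict Implicit.
Unset Printing Implicit Defensive.
Import GRing.Theory.
Local Open Scope ring_scope.

(** The extended natural numbers: [None] stands for infinity. *)
Definition enat := option nat.

Definition enat_le_nat (e : enat) (n : nat) : bool :=
  if e is Some m then (m <= n)%N else false.

Definition efinite (e : enat) : Prop := e <> None.

Lemma exists_asbool (P : nat -> Prop) :
  (exists n, P n) -> exists n, (fun k => `[< P k >]) n.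
Proof. by case=> n Pn; exists n; apply/asboolP. Qed.

(** The least [n] satisfying [P], or infinity if there is none. *)
Definition eleast (P : nat -> Prop) : enat :=
  if pselect (exists n, P n) is left exP
  then Some (ex_minn (exists_asbool exP)) else None.

(** The supremum of [f x] for [x] in the class [Y], as its least upper bound;
    it is [Some 0] if [Y] is empty. *)
Definition esup (T : Type) (Y : T -> Prop) (f : T -> enat) : enat :=
  eleast (fun n => forall x, Y x -> enat_le_nat (f x) n).

(** A right [R]-module is a left module over the converse ring [R^c]:
    [r *: x] is the product of [x] by [r] on the right. *)
Definition rmod (R : pzRingType) := lmodType R^c.

Section Modules.
Variable R : pzRingType.
Local Notation rmod := (rmod R).
Implicit Types (M N : rmod) (X Y A B : rmod -> Prop).

Definition surjective_lin M N (f : {linear M -> N}) : Prop :=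
  forall y, exists x, f x = y.

Definition exact_at M N (L : rmod)
    (f : {linear M -> N}) (g : {linear N -> L}) : Prop :=
  forall y, g y = 0 <-> exists x, f x = y.

Definition short_exact M N (L : rmod)
    (f : {linear M -> N}) (g : {linear N -> L}) : Prop :=
  [/\ injective f, exact_at f g & surjective_lin g].

Definition zero_module M : Prop := forall x : M, x = 0.

Definition projective M : Prop :=
  forall (N L : rmod) (p : {linear N -> L}) (f : {linear M -> L}),
    surjective_lin p -> exists g : {linear M -> N}, forall x, p (g x) = f x.

Definition fin_gen M : Prop :=
  exists (n : nat) (v : 'I_n -> M),
    forall x, exists c : 'I_n -> R^c, x = \sum_(i < n) c i *: v i.

(** An exact sequence [... -> X_2 -> X_1 -> X_0 -> M -> 0]. *)
Record resolution M := Resolution {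
  res_obj :> nat -> rmod;
  res_d : forall n, {linear res_obj n.+1 -> res_obj n};
  res_aug : {linear res_obj 0 -> M};
  res_aug_surj : surjective_lin res_aug;
  res_exact0 : exact_at (res_d 0) res_aug;
  res_exactS : forall n, exact_at (res_d n.+1) (res_d n)
}.

Definition projective_resolution M (P : resolution M) : Prop :=
  forall n, projective (P n).

(** The vanishing of the [n]-th cohomology group of the complex of groups
    [0 -> Hom(P_0, N) -> Hom(P_1, N) -> Hom(P_2, N) -> ...]: every cocycle
    is a coboundary. *)
Definition cocycle M N (P : resolution M) n (f : {linear P n -> N}) : Prop :=
  forall x, f (res_d P n x) = 0.

Definition coboundary M N (P : resolution M) n :
    {linear P n -> N} -> Prop :=
  match n return {linear P n -> N} -> Prop with
  | 0 => fun f => forall x, f x = 0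
  | m.+1 => fun f =>
      exists g : {linear P m -> N}, forall x, f x = g (res_d P m x)
  end.

(** [Ext^n(M, N) = 0]. The group [Ext^n(M, N)] is the [n]-th cohomology group
    of [Hom(P, N)] for a projective resolution [P] of [M]; every [M] has one,
    and the result does not depend on the choice of [P]. *)
Definition Ext_zero n M N : Prop :=
  forall P : resolution M, projective_resolution P ->
    forall f : {linear P n -> N}, cocycle f -> coboundary f.

(** An exact sequence [0 -> X_n -> ... -> X_0 -> M -> 0] with all [X_i] in [X]
    is a resolution whose terms of index larger than [n] are zero. *)
Definition has_resolution_of_length X M n : Prop :=
  exists r : resolution M,
    (forall i, (i <= n)%N -> X (r i)) /\
    (forall i, (n < i)%N -> zero_module (r i)).

Definition resdim X M : enat := eleast (has_resolution_of_length X M).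
Definition resdim_class X Y : enat := esup Y (resdim X).

Definition pd M : enat := resdim projective M.

Definition rel_pd X M : enat :=
  eleast (fun n => forall N, X N -> forall j, (n < j)%N -> Ext_zero j M N).
Definition rel_pd_class X Y : enat := esup Y (rel_pd X).

(** The modules of [mod R]. *)
Definition fin_presented_infty M : Prop :=
  exists P : resolution M, projective_resolution P /\ forall n, fin_gen (P n).

Definition fin_pd M : Prop := efinite (pd M).
Definition fin_pd_small M : Prop := fin_pd M /\ fin_presented_infty M.

Definition cotorsion_pair A B : Prop :=
  (forall M, A M <-> forall N, B N -> Ext_zero 1 M N) /\
  (forall N, B N <-> forall M, A M -> Ext_zero 1 M N).

Definition complete_pair A B : Prop :=
  forall M,
    (exists (K L : rmod) (f : {linear K -> L}) (g : {linear L -> M}),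
       [/\ B K, A L & short_exact f g]) /\
    (exists (K L : rmod) (f : {linear M -> K}) (g : {linear K -> L}),
       [/\ B K, A L & short_exact f g]).

Definition hereditary_pair A B : Prop :=
  forall i M N, (0 < i)%N -> A M -> B N -> Ext_zero i M N.

Definition hereditary_complete_cotorsion_pair A B : Prop :=
  [/\ cotorsion_pair A B, complete_pair A B & hereditary_pair A B].

End Modules.

Definition Findim (R : pzRingType) : enat := esup (@fin_pd R) (@pd R).
Definition findim (R : pzRingType) : enat := esup (@fin_pd_small R) (@pd R).

(* Main.v *)
(** If [A] is the left class of a cotorsion pair, it contains the projective
    modules. So if [Ext^j(A, A) = 0] for [j > m] and [M] has an [A]-resolution of
    length [n], dimension shifting along it gives [Ext^j(M, Q) = 0] for [j > n + m]
    and [Q] projective. When [pd M = d] is finite, this bounds it: were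
    [d > n + m], the vanishing of [Ext^d(M, Q)] for [Q] the last term of a
    projective resolution of length [d] would split off that term. Conversely,
    projective resolutions are [A]-resolutions, and (projectives, all modules) is
    a cotorsion pair, for which [resdim] is [pd].

    Dimension shifting is done with the vanishing of [Ext^1] expressed by
    extension of maps and that of [Ext^(n+1)] by taking a syzygy. *)
Require Import Defs.
From HB Require Import structures.
From mathcomp Require Import all_boot all_algebra boolp functions.
Set Implicit Arguments.
Unset Strict Implicit.
Unset Printing Implicit Defensive.
Import GRing.Theory.
Local Open Scope ring_scope.

(** * Modules and linear maps *)

Section Submodule.
Variables (R : pzRingType) (M : lmodType R) (S : {pred M}).
Hypothesis S_closed : submod_closed S.

(** The closure proof is a parameter of the type, so that its module structure can be inferred. *)
Definition submodule of submod_closed S := {x : M | x \in S}.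
Local Notation sub := (submodule S_closed).

HB.instance Definition _ := GRing.isSubmodClosed.Build R M S S_closed.
HB.instance Definition _ := SubChoice.on sub.
HB.instance Definition _ := [SubChoice_isSubZmodule of sub by <:].
HB.instance Definition _ := [SubZmodule_isSubLmodule of sub by <:].
End Submodule.

Section LinearMaps.
Variable R : pzRingType.
Implicit Types (K L M N Q X Y Z : rmod R).

Lemma linear_exists M N (f : M -> N) :
  linear f -> exists g : {linear M -> N}, forall x, g x = f x.
Proof.
move=> f_lin.
by exists (HB.pack_for {linear M -> N} f (GRing.isLinear.Build _ _ _ _ f f_lin)).
Qed.

(** Two values related to the same [x] differ by something related to [0], so the relation is the
    graph of a function. The maps out of quotients, pushouts and pullbacks below are described by
    such relations. *)
Lemma linear_of_relation M N (G : M -> N -> Prop) :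
    (forall x, exists y, G x y) ->
    (forall a x x' y y', G x y -> G x' y' -> G (a *: x + x') (a *: y + y')) ->
    (forall y, G 0 y -> y = 0) ->
  exists g : {linear M -> N}, forall x, G x (g x).
Proof.
move=> /choice[g gP] G_lin G0.
have G_fun x y : G x y -> y = g x.
  move=> Gxy; apply/eqP; rewrite eq_sym -subr_eq0 addrC -scaleN1r; apply/eqP.
  by apply: G0; rewrite -(addNr x) -scaleN1r; apply: G_lin.
have [|h hE] := @linear_exists _ _ g.
  by move=> a x y; apply/esym/G_fun/G_lin.
by exists h => x; rewrite hE.
Qed.

Lemma lift_injective K M X (i : {linear K -> M}) (h : {linear X -> M}) :
    injective i -> (forall x, exists k, i k = h x) ->
  exists h' : {linear X -> K}, forall x, i (h' x) = h x.
Proof.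
move=> i_inj h_im.
apply: (@linear_of_relation _ _ (fun x k => i k = h x)) => //.
- by move=> a x x' k k' ik ik'; rewrite !linearP ik ik'.
- by move=> k; rewrite linear0 -(linear0 i) => /i_inj.
Qed.

Lemma factor_surjective X Y N (p : {linear X -> Y}) (f : {linear X -> N}) :
    surjective_lin p -> (forall x, p x = 0 -> f x = 0) ->
  exists g : {linear Y -> N}, forall x, g (p x) = f x.
Proof.
move=> p_surj pf0.
have [||| g gP] := @linear_of_relation _ _
  (fun y n => exists2 x, p x = y & f x = n).
- by move=> y; have [x <-] := p_surj y; exists (f x), x.
- by move=> a _ _ _ _ [x <- <-] [x' <- <-]; exists (a *: x + x'); rewrite linearP.
- by move=> _ [x px0 <-]; apply: pf0.
exists g => x; have [x' pp' <-] := gP (p x).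
apply/eqP; rewrite -subr_eq0 -linearB; apply/eqP/pf0.
by rewrite linearB pp' subrr.
Qed.

Lemma submodule_exists M (S : {pred M}) : submod_closed S ->
  exists (K : rmod R) (i : {linear K -> M}),
    injective i /\ forall x, x \in S <-> exists k, i k = x.
Proof.
move=> S_closed.
exists (submodule S_closed : rmod R), (val : {linear submodule S_closed -> M}).
split=> [|x]; first exact: val_inj.
by split=> [Sx | [z <-]]; [exists (exist _ x Sx) | apply: (valP z)].
Qed.

Lemma kernel_exists M N (g : {linear M -> N}) :
  exists (K : rmod R) (i : {linear K -> M}), injective i /\ exact_at i g.
Proof.
have [|K [i [i_inj iP]]] := @submodule_exists M [pred x | g x == 0].
  split=> [|a x y]; rewrite !inE ?linear0 //.
  by move=> /eqP gx /eqP gy; rewrite linearP gx gy scaler0 addr0.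
by exists K, i; split=> // x; rewrite -iP; split => /eqP.
Qed.

Lemma exact_comp0 K M N (i : {linear K -> M}) (p : {linear M -> N}) :
  exact_at i p -> forall k, p (i k) = 0.
Proof. by move=> ip k; apply/ip; exists k. Qed.

Definition retract M X :=
  exists (s : {linear M -> X}) (r : {linear X -> M}), forall x, r (s x) = x.

Lemma retract_iso M X (f : {linear X -> M}) :
  injective f -> surjective_lin f -> retract M X.
Proof.
move=> f_inj f_surj; have [g gP] := lift_injective (h := idfun) f_inj f_surj.
by exists g, f.
Qed.

Lemma section_retract K Y L (i : {linear K -> Y}) (p : {linear Y -> L})
    (s : {linear L -> Y}) :
  short_exact i p -> (forall x, p (s x) = x) -> retract K Y.
Proof.
move=> [i_inj ip p_surj] ps.
have [|h hE] := @linear_exists Y Y (fun y => y - s (p y)).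
  by move=> a x y; rewrite !linearP scalerDr addrACA.
have [x|r rP] := lift_injective (h := h) i_inj.
  by apply/ip; rewrite hE linearB ps subrr.
exists i, r => k; apply: i_inj; rewrite rP hE.
by rewrite (exact_comp0 ip) linear0 subr0.
Qed.

Lemma retraction_retract K Y L (i : {linear K -> Y}) (p : {linear Y -> L})
    (r : {linear Y -> K}) :
  short_exact i p -> (forall x, r (i x) = x) -> retract L Y.
Proof.
move=> [i_inj ip p_surj] ri.
have [|h hE] := @linear_exists Y Y (fun y => y - i (r y)).
  by move=> a x y; rewrite !linearP scalerDr addrACA.
have [y /ip[k <-]|s sP] := factor_surjective (f := h) p_surj.
  by rewrite hE ri subrr.
exists s, p => x; have [y <-] := p_surj x; rewrite sP hE linearB.
by rewrite (exact_comp0 ip) subr0.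
Qed.

(** This elementwise form is symmetric in the two maps, so a fact about one projection transfers to
    the other. *)
Definition pullback_square M X Y Z (p : {linear Y -> M}) (r : {linear X -> M})
    (a : {linear Z -> Y}) (b : {linear Z -> X}) :=
  [/\ forall z, p (a z) = r (b z),
      forall z z', a z = a z' -> b z = b z' -> z = z' &
      forall y x, p y = r x -> exists2 z, a z = y & b z = x].

Lemma pullback_exists M X Y (p : {linear Y -> M}) (r : {linear X -> M}) :
  exists (Z : rmod R) (a : {linear Z -> Y}) (b : {linear Z -> X}),
    pullback_square p r a b.
Proof.
have [|h hE] := @linear_exists (Y * X)%type M (fun z => p z.1 - r z.2).
  by move=> a x y /=; rewrite !linearP scalerDr addrACA.
have [Z [k [k_inj kh]]] := kernel_exists h.
exists Z, (fst \o k), (snd \o k); split=> /=.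
- move=> z; apply/eqP; rewrite -subr_eq0; apply/eqP.
  by rewrite -(hE (k z)); apply/kh; exists z.
- by move=> z z' a_eq b_eq; apply: k_inj; apply/eqP/andP; split; apply/eqP.
- move=> y x pr; have /kh[z kz] : h (y, x) = 0 by rewrite hE /= pr subrr.
  by exists z; rewrite /= kz.
Qed.

Lemma pullback_square_sym M X Y Z (p : {linear Y -> M}) (r : {linear X -> M})
    (a : {linear Z -> Y}) (b : {linear Z -> X}) :
  pullback_square p r a b -> pullback_square r p b a.
Proof.
move=> [comm inj ex]; split=> // [z z' ? ?|x y rp]; first exact: inj.
by have [z] := ex y x (esym rp); exists z.
Qed.

(** The kernel of [b] is that of [p]: [k] corresponds to the compatible pair [(i k, 0)]. *)
Lemma pullback_short_exact K M X Y Z (i : {linear K -> Y})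
    (p : {linear Y -> M}) (r : {linear X -> M})
    (a : {linear Z -> Y}) (b : {linear Z -> X}) :
    pullback_square p r a b -> short_exact i p ->
  exists2 j : {linear K -> Z}, short_exact j b & forall k, a (j k) = i k.
Proof.
move=> [comm inj ex] [i_inj ip p_surj].
have [| | | j jP] := @linear_of_relation K Z (fun k z => a z = i k /\ b z = 0).
- move=> k; have [|z az bz] := ex (i k) 0; last by exists z.
  by rewrite linear0; apply/ip; exists k.
- move=> c k k' z z' [az bz] [az' bz'].
  by rewrite !linearP az az' bz bz' scaler0 addr0.
- by move=> z [az bz]; apply: inj; rewrite ?az ?bz !linear0.
exists j => [|k]; last by have [] := jP k.
split.
- by move=> k k' jk; apply: i_inj; rewrite -!(proj1 (jP _)) jk.
- move=> z; split=> [bz|[k <-]]; last by have [] := jP k.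
  have /ip[k ik] : p (a z) = 0 by rewrite comm bz linear0.
  by exists k; apply: inj; have [aj bj] := jP k; rewrite ?aj ?bj.
- by move=> x; have [y py] := p_surj (r x); have [z _ <-] := ex y x py; exists z.
Qed.

(** The preimage [L] of [A] in [Q], for [A -> B -> C] exact and [Q -> B] onto. *)
Lemma preimage_exists (A B C K Q : rmod R) (i : {linear A -> B})
    (p : {linear B -> C}) (k : {linear K -> Q}) (q : {linear Q -> B}) :
    short_exact i p -> short_exact k q ->
  exists (L : rmod R) (l : {linear L -> Q}) (k' : {linear K -> L})
    (q' : {linear L -> A}),
    [/\ short_exact l (p \o q), short_exact k' q', forall x, l (k' x) = k x &
        forall x, i (q' x) = q (l x)].
Proof.
move=> [i_inj ip p_surj] [k_inj kq q_surj].
have [L [l [l_inj lpq]]] := kernel_exists (p \o q).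
have [x|k' k'P] := lift_injective (h := k) l_inj.
  by apply/lpq; rewrite /= (exact_comp0 kq) linear0.
have [x|q' q'P] := lift_injective (h := q \o l) i_inj.
  by apply/ip/(lpq (l x)); exists x.
exists L, l, k', q'; split=> //; split=> //.
- by move=> c; have [b <-] := p_surj c; have [y <-] := q_surj b; exists y.
- by move=> x y /(congr1 l); rewrite !k'P => /k_inj.
- move=> x; split=> [q'x | [y <-]].
    have /kq[y ky] : q (l x) = 0 by rewrite -[LHS]q'P q'x linear0.
    by exists y; apply: l_inj; rewrite k'P.
  apply: i_inj; rewrite q'P /= k'P linear0; apply: exact_comp0 kq _.
- move=> a; have [y qy] := q_surj (i a).
  have /lpq[x lx] : p (q y) = 0 by rewrite qy; apply/ip; exists a.
  by exists x; apply: i_inj; rewrite q'P /= lx.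
Qed.

End LinearMaps.

(** * Projective modules *)

Section Projective.
Variable R : pzRingType.
Implicit Types (L M N Q X : rmod R).

Lemma retract_projective M X : retract M X -> projective X -> projective M.
Proof.
move=> [s [r rs]] X_proj N L p f p_surj.
have [g gP] := X_proj N L p (f \o r) p_surj.
by exists (g \o s) => x /=; rewrite gP /= rs.
Qed.

Lemma zero_projective M : zero_module M -> projective M.
Proof.
move=> M0 N L p f p_surj; have [|g gE] := @linear_exists R M N (fun=> 0).
  by move=> a x y; rewrite scaler0 addr0.
by exists g => x; rewrite gE (M0 x) !linear0.
Qed.

Lemma prod_projective Q Q' :
  projective Q -> projective Q' -> projective (Q * Q' : rmod R)%type.
Proof.
move=> Q_proj Q'_proj N L p f p_surj.
have [|f1 f1E] := @linear_exists R Q L (fun q => f (q, 0)).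
  move=> a x y; rewrite -linearP; congr (f _).
  by apply: injective_projections; rewrite /= ?scaler0 ?addr0.
have [|f2 f2E] := @linear_exists R Q' L (fun q => f (0, q)).
  move=> a x y; rewrite -linearP; congr (f _).
  by apply: injective_projections; rewrite /= ?scaler0 ?addr0.
have [g1 g1P] := Q_proj _ _ _ f1 p_surj.
have [g2 g2P] := Q'_proj _ _ _ f2 p_surj.
have [|g gE] := @linear_exists R (Q * Q')%type N (fun q => g1 q.1 + g2 q.2).
  by move=> a x y /=; rewrite !linearP scalerDr addrACA.
exists g => -[x y]; rewrite gE linearD g1P g2P f1E f2E -linearD.
by congr (f _); apply: injective_projections; rewrite /= (addr0, add0r).
Qed.

End Projective.

(** * Free modules, and projective modules mapping onto a given one *)

Section FreeModule.
Variables (R : pzRingType) (T : choiceType).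
Local Notation fct := (T -> R^c^o).
Implicit Types (f : fct) (s t : seq T).

Definition supported_by f s := forall x, x \notin s -> f x = 0.

Definition finitely_supported : {pred fct} :=
  fun f => `[< exists s, supported_by f s >].

Lemma finitely_supported_closed : submod_closed finitely_supported.
Proof.
split=> [|a f g /asboolP[s fs] /asboolP[t gt]]; apply/asboolP; first by exists [::].
exists (s ++ t) => x; rewrite mem_cat negb_or => /andP[xs xt].
by rewrite !fctE fs // gt // scaler0 addr0.
Qed.

Lemma sum_supported_by (N : rmod R) (c : T -> N) f s t :
    uniq s -> uniq t -> {subset s <= t} -> supported_by f s ->
  \sum_(x <- t) (f x : R^c) *: c x = \sum_(x <- s) (f x : R^c) *: c x.
Proof.
move=> s_uniq t_uniq st fs; rewrite (bigID (mem s)) /= [X in _ + X]big1 ?addr0.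
  rewrite -big_filter; apply/perm_big/uniq_perm; rewrite ?filter_uniq //.
  by move=> x; rewrite mem_filter; apply/andb_idr/st.
by move=> x xs; rewrite fs // scale0r.
Qed.

Variables (F : rmod R) (coef : {linear F -> fct}).
Hypothesis coef_inj : injective coef.
Hypothesis coefP : forall f, f \in finitely_supported <-> exists m, coef m = f.

(** The support [s] is existentially quantified because the sum does not depend on it: two supports
    are compared inside their union by [sum_supported_by]. *)
Lemma free_module_universal (N : rmod R) (c : T -> N) :
  exists g : {linear F -> N}, forall m, exists s,
    [/\ uniq s, supported_by (coef m) s &
        g m = \sum_(x <- s) (coef m x : R^c) *: c x].
Proof.
apply: (@linear_of_relation R F N (fun m n => exists s,
  [/\ uniq s, supported_by (coef m) s &
      n = \sum_(x <- s) (coef m x : R^c) *: c x])).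
- move=> m; have /asboolP[s ms] : coef m \in finitely_supported.
    by apply/coefP; exists m.
  exists (\sum_(x <- undup s) (coef m x : R^c) *: c x), (undup s).
  by rewrite undup_uniq; split=> // x; rewrite mem_undup => /ms.
- move=> a m m' _ _ [s [s_uniq ms ->]] [s' [s'_uniq ms' ->]].
  pose t := undup (s ++ s').
  have t_uniq : uniq t by apply: undup_uniq.
  exists t; split=> // [x|].
    rewrite mem_undup mem_cat negb_or linearP => /andP[xs xs'].
    by rewrite !fctE ms // ms' // scaler0 addr0.
  rewrite -(sum_supported_by c s_uniq t_uniq _ ms); last first.
    by move=> x xs; rewrite mem_undup mem_cat xs.
  rewrite -(sum_supported_by c s'_uniq t_uniq _ ms'); last first.
    by move=> x xs; rewrite mem_undup mem_cat xs orbT.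
  rewrite scaler_sumr -big_split; apply: eq_bigr => x _.
  by rewrite linearP !fctE scalerDl scalerA.
- move=> _ [s [_ _ ->]]; rewrite big1 // => x _.
  by rewrite linear0; apply: scale0r.
Qed.

Lemma free_generators : exists e : T -> F,
  forall x y, coef (e x) y = (x == y)%:R.
Proof.
have [x|e eP] := @choice T F (fun x m => coef m = fun y => (x == y)%:R).
  apply/coefP/asboolP; exists [:: x] => y; rewrite inE eq_sym.
  by move/negbTE=> ->.
by exists e => x y; rewrite eP.
Qed.

Lemma free_module_decomposition (e : T -> F) m s :
    (forall x y, coef (e x) y = (x == y)%:R) ->
    uniq s -> supported_by (coef m) s ->
  m = \sum_(x <- s) (coef m x : R^c) *: e x.
Proof.
move=> eE s_uniq ms; apply/coef_inj/funext => y.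
rewrite linear_sum fct_sumE.
have cE x : coef ((coef m x : R^c) *: e x) y = (coef m x : R^c) * (x == y)%:R.
  by rewrite linearZ -eE.
rewrite (eq_bigr _ (fun x _ => cE x)).
have [ys|ys] := boolP (y \in s); last first.
  rewrite ms // big_seq big1 // => x xs.
  by case: eqP xs ys => [-> -> //|_ _ _]; rewrite mulr0.
rewrite (bigD1_seq y) //= eqxx mulr1 big1 ?addr0 // => x /negbTE->.
by rewrite mulr0.
Qed.

Lemma free_module_projective : projective F.
Proof.
move=> N L p f p_surj; have [e eE] := free_generators.
have [c cP] := choice (fun x => p_surj (f (e x))).
have [g gP] := free_module_universal c; exists g => m.
have [s [s_uniq ms ->]] := gP m.
rewrite [in RHS](free_module_decomposition eE s_uniq ms) !linear_sum.
by apply: eq_bigr => x _; rewrite !linearZ cP.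
Qed.

End FreeModule.

(** The free module on the underlying set of [M] maps onto [M] by extending the identity. *)
Lemma cover_exists (R : pzRingType) (M : rmod R) :
  exists (K Q : rmod R) (i : {linear K -> Q}) (p : {linear Q -> M}),
    projective Q /\ short_exact i p.
Proof.
have [F [coef [coef_inj coefP]]] :=
  @submodule_exists R (M -> R^c^o) _ (@finitely_supported_closed R M).
have [p pP] := free_module_universal coefP (fun x : M => x).
have [K [i [i_inj ip]]] := kernel_exists p.
exists K, F, i, p; split; first exact: free_module_projective coef_inj coefP.
split=> // x; have [e eE] := free_generators coefP; exists (e x).
have [s [s_uniq es ->]] := pP (e x).
(* The coefficient of [e x] at [x] is [1]. If [x] lies outside a support, then [1 = 0] in [R], and
   every module is zero. *)
have [xs|xs] := boolP (x \in s); last first.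
  have R0 : 1 = 0 :> R^c by rewrite -(es x xs) eE eqxx.
  have M0 (y : M) : y = 0 by rewrite -(scale1r y) R0 scale0r.
  by rewrite [LHS]M0 [RHS]M0.
rewrite (bigD1_seq x) //= eE eqxx scale1r big1 ?addr0 // => y.
by rewrite eE eq_sym => /negbTE->; rewrite scale0r.
Qed.

(** * Vanishing of [Ext] *)

Section ExtVanishing.
Variables (R : pzRingType) (N : rmod R).
Implicit Types (A B C K L M Q X Y Z : rmod R).

(** [Ext^1(M, N) = 0]. *)
Definition ext1_vanish M :=
  forall K Y (i : {linear K -> Y}) (p : {linear Y -> M}), short_exact i p ->
  forall f : {linear K -> N}, exists g : {linear Y -> N}, forall k, g (i k) = f k.

(** [Ext^(n+1)(M, N) = 0], by dimension shifting. *)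
Fixpoint ext_vanish n M : Prop :=
  if n is n'.+1 then
    exists K Q (i : {linear K -> Q}) (p : {linear Q -> M}),
      [/\ projective Q, short_exact i p & ext_vanish n' K]
  else ext1_vanish M.

(** A single projective presentation tests all extensions: any extension [Y] of [M] is a pushout of
    it, since [Q] is projective and [p] lifts to [phi : Q -> Y]. *)
Lemma ext1_vanish_cover M K Q (i : {linear K -> Q}) (p : {linear Q -> M}) :
    projective Q -> short_exact i p ->
    (forall f : {linear K -> N},
       exists g : {linear Q -> N}, forall k, g (i k) = f k) ->
  ext1_vanish M.
Proof.
move=> Q_proj [i_inj ip p_surj] ext K' Y i' p' [i'_inj ip' p'_surj] f.
have [phi phiP] := Q_proj _ _ _ p p'_surj.
have [k|psi psiP] := lift_injective (h := phi \o i) i'_inj.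
  by apply/ip'; rewrite /= phiP; apply/ip; exists k.
have [h hP] := ext (f \o psi).
(* [Y] is generated by the images of [i'] and [phi], which overlap along [K]; there [f] and [h]
   agree by the choice of [h], so they glue. *)
have [| | | g gP] := @linear_of_relation R Y N (fun y n =>
  exists k q, y = i' k + phi q /\ n = f k + h q).
- move=> y; have [q pq] := p_surj (p' y).
  have /ip'[k kE] : p' (y - phi q) = 0 by rewrite linearB phiP pq subrr.
  by exists (f k + h q), k, q; rewrite kE subrK.
- move=> a _ _ _ _ [k [q [-> ->]]] [k' [q' [-> ->]]].
  exists (a *: k + k'), (a *: q + q').
  by rewrite !linearP !scalerDr; split; rewrite addrACA.
- move=> _ [k [q [kq ->]]].
  have /ip[k0 k0q] : p q = 0.
    by rewrite -phiP -(linear0 p') kq linearD (exact_comp0 ip') add0r.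
  rewrite -k0q hP /= -linearD; suff -> : k + psi k0 = 0 by rewrite linear0.
  by apply: i'_inj; rewrite linearD psiP /= k0q -kq linear0.
exists g => k; have [k' [q [kE ->]]] := gP (i' k).
have /ip[k0 k0q] : p q = 0.
  by have := exact_comp0 ip' k; rewrite kE linearD (exact_comp0 ip') add0r phiP.
rewrite -k0q hP /= -linearD; congr (f _).
by apply: i'_inj; rewrite linearD psiP /= k0q kE.
Qed.

(** Pull the extension [Y] of [M] back along [r] to an extension [Z] of [X], and extend [f] to [Z].
    The identity of [Y] and [s \o p] define a map from [Y] back to [Z], because [r \o s] is the
    identity. *)
Lemma ext1_vanish_retract M X : retract M X -> ext1_vanish X -> ext1_vanish M.
Proof.
move=> [s [r rs]] X_ext K Y i p ip f.
have [Z [a [b sq]]] := pullback_exists p r.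
have [j jb aj] := pullback_short_exact sq ip.
have [h hP] := X_ext _ _ _ _ jb f.
have [comm inj ex] := sq.
have [| | | t tP] := @linear_of_relation R Y Z (fun y z => a z = y /\ b z = s (p y)).
- by move=> y; have [|z az bz] := ex y (s (p y)); [rewrite rs | exists z].
- by move=> c y y' z z' [<- bz] [<- bz']; rewrite !linearP bz bz'.
- by move=> z [az bz]; apply: inj; rewrite ?az ?bz !linear0.
exists (h \o t) => k /=; rewrite -hP; congr (h _).
have [at_ bt] := tP (i k); have [_ jb0 _] := jb; have [_ ip0 _] := ip.
apply: inj; first by rewrite at_ aj.
by rewrite bt (exact_comp0 jb0) (exact_comp0 ip0) linear0.
Qed.

Lemma ext1_vanish_projective Q : projective Q -> ext1_vanish Q.
Proof.
move=> Q_proj K Y i p ip f; have [_ _ p_surj] := ip.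
have [s sP] := Q_proj _ _ _ (idfun : {linear Q -> Q}) p_surj.
have [i_inj ip0 _] := ip.
have [|h hE] := @linear_exists R Y Y (fun y => y - s (p y)).
  by move=> a x y; rewrite !linearP scalerDr addrACA.
have [x|r rP] := lift_injective (h := h) i_inj.
  by apply/ip0; rewrite hE linearB sP subrr.
exists (f \o r) => k /=; congr (f _); apply: i_inj; rewrite rP hE.
by rewrite (exact_comp0 ip0) linear0 subr0.
Qed.

(** The map is extended in two stages: from [K] to the preimage [L] of [A], an extension of [A] by
    [K], and then from [L] to [Y], an extension of [C] by [L]. *)
Lemma ext1_vanish_middle A B C (i : {linear A -> B}) (p : {linear B -> C}) :
  short_exact i p -> ext1_vanish A -> ext1_vanish C -> ext1_vanish B.
Proof.
move=> ip A_ext C_ext K Y k q kq f.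
have [L [l [k' [q' [lpq k'q' lk' _]]]]] := preimage_exists ip kq.
have [g gP] := A_ext _ _ _ _ k'q' f.
have [h hP] := C_ext _ _ _ _ lpq g.
by exists h => x; rewrite -lk' hP gP.
Qed.

(** Projecting the pullback [X] of [Q -> A <- L] to [L] and to [Q] gives exact
    sequences [0 -> K' -> X -> L -> 0] and [0 -> K -> X -> Q -> 0], the second
    of which splits. *)
Lemma ext_vanish_kernel_step n A K L (i : {linear K -> L}) (p : {linear L -> A}) :
    (forall A B C (i : {linear A -> B}) (p : {linear B -> C}),
       short_exact i p -> ext_vanish n A -> ext_vanish n C -> ext_vanish n B) ->
    (forall M X, retract M X -> ext_vanish n X -> ext_vanish n M) ->
  short_exact i p -> ext_vanish n L -> ext_vanish n.+1 A -> ext_vanish n K.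
Proof.
move=> middle retr ip L_ext [K' [Q [j [q [Q_proj jq K'_ext]]]]].
have [X [a [b sq]]] := pullback_exists p q.
have [k kb _] := pullback_short_exact sq ip.
have [k' k'a _] := pullback_short_exact (pullback_square_sym sq) jq.
have X_ext := middle _ _ _ _ _ k'a K'_ext L_ext.
have [_ _ b_surj] := kb.
have [s sP] := Q_proj _ _ _ (idfun : {linear Q -> Q}) b_surj.
exact: retr (section_retract kb sP) X_ext.
Qed.

Lemma ext_vanish_projective n Q : projective Q -> ext_vanish n Q.
Proof.
elim: n Q => [|n IHn] Q Q_proj; first exact: ext1_vanish_projective.
have [K [i [i_inj ip]]] := kernel_exists (idfun : {linear Q -> Q}).
exists K, Q, i, idfun; split=> //; first by split=> // x; exists x.
apply/IHn/zero_projective => k; apply: i_inj; rewrite linear0.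
by apply/ip; exists k.
Qed.

(** The two closure properties are proved together: in degree [n] they give the kernel step, which
    in turn yields each of them in degree [n.+1]. *)
Lemma ext_vanish_middle_retract n :
  (forall A B C (i : {linear A -> B}) (p : {linear B -> C}),
     short_exact i p -> ext_vanish n A -> ext_vanish n C -> ext_vanish n B) /\
  (forall M X, retract M X -> ext_vanish n X -> ext_vanish n M).
Proof.
elim: n => [|n [middle retr]].
  by split; [apply: ext1_vanish_middle | apply: ext1_vanish_retract].
have kernel A K L (i : {linear K -> L}) (p : {linear L -> A}) :
  short_exact i p -> ext_vanish n L -> ext_vanish n.+1 A -> ext_vanish n K.
  exact: ext_vanish_kernel_step.
split=> [A B C i p ip A_ext C_ext | M X [s [r rs]] X_ext].
  have [K [Q [k [q [Q_proj kq]]]]] := cover_exists B.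
  exists K, Q, k, q; split=> //.
  (* [L] is a syzygy of [C], with cover [Q], and [K] is the kernel of [L -> A], so the kernel step
     applies twice. *)
  have [L [l [k' [q' [lpq k'q' _ _]]]]] := preimage_exists ip kq.
  apply: (kernel _ _ _ _ _ k'q' _ A_ext).
  by apply: (kernel _ _ _ _ _ lpq _ C_ext); apply: ext_vanish_projective.
have [K [Q [k [q [Q_proj kq]]]]] := cover_exists M.
exists K, Q, k, q; split=> //.
(* [M'] is a complement of [M] in [X], so covers of [M] and [M'] add up to a cover [h] of [X] by
   [Q * Q']. Its kernel [L] inherits the vanishing, and [K] is a retract of [L] through
   [x |-> (k x, 0)] and the first projection. *)
have [M' [i [i_inj ir]]] := kernel_exists r.
have [K' [Q' [k' [q' [Q'_proj [k'_inj k'q' q'_surj]]]]]] := cover_exists M'.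
have [k_inj kq0 q_surj] := kq.
have [|h hE] := @linear_exists R (Q * Q')%type X (fun z => s (q z.1) + i (q' z.2)).
  by move=> a x y /=; rewrite !linearP scalerDr addrACA.
have [L [l [l_inj lh]]] := kernel_exists h.
have L_ext : ext_vanish n L.
  apply: (kernel _ _ _ l h _ _ X_ext); last first.
    exact: ext_vanish_projective (prod_projective Q_proj Q'_proj).
    split=> [||x]; [exact: l_inj | exact: lh |].
  have [z qz] := q_surj (r x).
  have /ir[m im] : r (x - s (r x)) = 0 by rewrite linearB rs subrr.
  have [z' qz'] := q'_surj m.
  by exists (z, z'); rewrite hE /= qz qz' im addrC subrK.
have [|c cE] := @linear_exists R K (Q * Q')%type (fun x => (k x, 0)).
  move=> a x y; rewrite linearP; apply: injective_projections => //=.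
  by rewrite scaler0 addr0.
have [x|d dP] := lift_injective (h := c) l_inj.
  by apply/lh; rewrite hE cE /= (exact_comp0 kq0) !linear0 addr0.
have [x|e eP] := lift_injective (h := fst \o l) k_inj.
  apply/kq0 => /=; rewrite -(rs (q (l x).1)).
  have : r (h (l x)) = 0 by rewrite (exact_comp0 lh) linear0.
  by rewrite hE linearD (exact_comp0 ir) addr0.
apply: retr L_ext; exists d, e => x.
by apply: k_inj; rewrite eP /= dP cE.
Qed.

Lemma ext_vanish_middle n A B C (i : {linear A -> B}) (p : {linear B -> C}) :
  short_exact i p -> ext_vanish n A -> ext_vanish n C -> ext_vanish n B.
Proof. exact: (proj1 (ext_vanish_middle_retract n)). Qed.

Lemma ext_vanish_retract n M X :
  retract M X -> ext_vanish n X -> ext_vanish n M.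
Proof. exact: (proj2 (ext_vanish_middle_retract n)). Qed.

Lemma ext_vanish_kernel n A K L (i : {linear K -> L}) (p : {linear L -> A}) :
  short_exact i p -> ext_vanish n L -> ext_vanish n.+1 A -> ext_vanish n K.
Proof.
apply: ext_vanish_kernel_step; first exact: ext_vanish_middle.
exact: ext_vanish_retract.
Qed.

Lemma ext_vanish_syzygy n M K Q (i : {linear K -> Q}) (p : {linear Q -> M}) :
  projective Q -> short_exact i p -> ext_vanish n.+1 M -> ext_vanish n K.
Proof.
by move=> Q_proj ip; apply: (ext_vanish_kernel ip); apply: ext_vanish_projective.
Qed.

(** A projective [Q] mapping onto [B] also maps onto [C]; the kernel of [Q -> C] is an extension of
    [A] by the syzygy [K] of [B]. *)
Lemma ext_vanish_cokernel n A B C (i : {linear A -> B}) (p : {linear B -> C}) :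
  short_exact i p -> ext_vanish n A -> ext_vanish n.+1 B -> ext_vanish n.+1 C.
Proof.
move=> ip A_ext B_ext.
have [K [Q [k [q [Q_proj kq]]]]] := cover_exists B.
have [L [l [k' [q' [lpq k'q' _ _]]]]] := preimage_exists ip kq.
exists L, Q, l, (p \o q); split=> //.
exact: (ext_vanish_middle k'q' (ext_vanish_syzygy Q_proj kq B_ext) A_ext).
Qed.

End ExtVanishing.

(** * Resolutions *)

Section Resolutions.
Variable R : pzRingType.
Implicit Types (K L M N Q : rmod R) (X A B : rmod R -> Prop).

Lemma syzygy_exists M (r : resolution M) :
  exists K (i : {linear K -> r 0}) (p : {linear r 1 -> K}),
    short_exact i (res_aug r) /\ forall x, i (p x) = res_d r 0 x.
Proof.
have [K [i [i_inj iaug]]] := kernel_exists (res_aug r).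
have [x|p pP] := lift_injective (h := res_d r 0) i_inj.
  exact/iaug/exact_comp0/res_exact0.
by exists K, i, p; split=> //; split=> //; apply: res_aug_surj.
Qed.

(** * Shifting and splicing resolutions *)

Section Shift.
Variables (M K : rmod R) (r : resolution M).
Variables (i : {linear K -> r 0}) (p : {linear r 1 -> K}).
Hypothesis ir : short_exact i (res_aug r).
Hypothesis ipE : forall x, i (p x) = res_d r 0 x.

Lemma shift_surjective : surjective_lin p.
Proof.
have [i_inj iaug _] := ir; move=> k.
have /res_exact0[x dx] := exact_comp0 iaug k.
by exists x; apply: i_inj; rewrite ipE.
Qed.

Lemma shift_exact : exact_at (res_d r 1) p.
Proof.
have [i_inj _ _] := ir; move=> x; rewrite -(res_exactS x) -ipE.
by split=> [->|]; [apply: linear0 | rewrite -[RHS](linear0 i) => /i_inj].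
Qed.

Definition shift_resolution : resolution K :=
  @Resolution R K (fun n => r n.+1) (fun n => res_d r n.+1) p
    shift_surjective shift_exact (fun n => @res_exactS _ _ r n.+1).

End Shift.

Section Splice.
Variables (M K Q : rmod R) (i : {linear K -> Q}) (p : {linear Q -> M}).
Variable r : resolution K.
Hypothesis ip : short_exact i p.

Definition splice_obj n : rmod R := if n is n'.+1 then r n' else Q.

Definition splice_d n : {linear splice_obj n.+1 -> splice_obj n} :=
  match n return {linear splice_obj n.+1 -> splice_obj n} with
  | 0 => i \o res_aug r
  | n'.+1 => res_d r n'
  end.

Lemma splice_surjective : surjective_lin (p : {linear splice_obj 0 -> M}).
Proof. by case: ip. Qed.

Lemma splice_exact0 : exact_at (splice_d 0) (p : {linear splice_obj 0 -> M}).
Proof.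
have [_ ip0 _] := ip; move=> x; split=> [/ip0[k <-]|[y <-]].
  by have [y <-] := res_aug_surj r k; exists y.
exact: (exact_comp0 ip0).
Qed.

Lemma splice_exactS n : exact_at (splice_d n.+1) (splice_d n).
Proof.
case: n => [|n] /=; last exact: res_exactS.
have [i_inj _ _] := ip; move=> x; rewrite -(res_exact0 x) /=.
by split=> [|->]; [rewrite -[RHS](linear0 i) => /i_inj | apply: linear0].
Qed.

Definition splice_resolution : resolution M :=
  @Resolution R M splice_obj splice_d p
    splice_surjective splice_exact0 splice_exactS.

End Splice.

Lemma projective_resolution_exists M :
  exists P : resolution M, projective_resolution P.
Proof.
(* A projective presentation is chosen for all modules at once, one component at a time; iterating
   the chosen kernel [K] gives the syzygies [omega n]. *)
pose ex1 L := cid (cover_exists L); pose K L := sval (ex1 L).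
pose ex2 L := cid (svalP (ex1 L)); pose Q L := sval (ex2 L).
pose ex3 L := cid (svalP (ex2 L)); pose i L := sval (ex3 L).
pose ex4 L := cid (svalP (ex3 L)); pose p L := sval (ex4 L).
have cover L : projective (Q L) /\ short_exact (i L) (p L) := svalP (ex4 L).
pose omega n := iter n K M.
have pi0 n : exact_at (i (omega n)) (p (omega n)).
  by have [_ []] := cover (omega n).
have p_surj n : surjective_lin (p (omega n)).
  by have [_ []] := cover (omega n).
pose d n : {linear Q (omega n.+1) -> Q (omega n)} :=
  i (omega n) \o p (omega n.+1).
have d0 n : exact_at (d n) (p (omega n)).
  move=> x; split=> [/pi0[k <-]|[y <-]]; last exact: (exact_comp0 (pi0 n)).
  by have [y <-] := p_surj n.+1 k; exists y.
have dS n : exact_at (d n.+1) (d n).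
  move=> x; rewrite -(d0 n.+1 x) /d /=.
  have [_ [i_inj _ _]] := cover (omega n).
  by split=> [|->]; [rewrite -[RHS](linear0 (i (omega n))) => /i_inj | apply: linear0].
exists (@Resolution R M (fun n => Q (omega n)) d (p M) (p_surj 0) (d0 0) dS).
by move=> n; have [] := cover (omega n).
Qed.

(** In degree one, a cocycle factors through the first syzygy, and extending it to [P 0] makes it a
    coboundary. In higher degrees, cocycles and coboundaries of [P] are by conversion those of the
    shifted resolution, one degree lower. *)
Lemma ext_vanish_Ext_zero n M N : ext_vanish N n M -> Ext_zero n.+1 M N.
Proof.
elim: n M => [|n IHn] M M_ext P P_proj f f_coc;
  have [K [i [p [ip ipE]]]] := syzygy_exists P; have [i_inj _ _] := ip.
  have [x /(shift_exact ip ipE)[y <-]|g gP] :=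
    factor_surjective (f := f) (shift_surjective ip ipE); first exact: f_coc.
  have [h hP] := M_ext _ _ _ _ ip g.
  by exists h => x; rewrite -ipE hP gP.
apply: (IHn K _ (shift_resolution ip ipE)) f_coc.
  exact: ext_vanish_syzygy (P_proj 0%N) ip M_ext.
by move=> m; apply: P_proj.
Qed.

(** [Ext_zero] quantifies over all projective resolutions, so it may be used on one that exists in
    degree one, and on splices of resolutions of a syzygy in higher degrees. *)
Lemma Ext_zero_ext_vanish n M N : Ext_zero n.+1 M N -> ext_vanish N n M.
Proof.
elim: n M => [|n IHn] M M_ext.
  have [P P_proj] := projective_resolution_exists M.
  have [K [i [p [ip ipE]]]] := syzygy_exists P.
  apply: (ext1_vanish_cover (P_proj 0%N) ip) => f.
  have [x|g gP] := M_ext P P_proj (f \o p).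
    by rewrite /= (exact_comp0 (shift_exact ip ipE)) linear0.
  exists g => k; have [x <-] := shift_surjective ip ipE k.
  by rewrite ipE -gP.
have [K [Q [i [p [Q_proj ip]]]]] := cover_exists M.
exists K, Q, i, p; split=> //; apply: IHn => P P_proj f f_coc.
apply: (M_ext (splice_resolution P ip)) f_coc => -[|m] //; exact: P_proj.
Qed.

Lemma Ext_zeroP n M N : Ext_zero n.+1 M N <-> ext_vanish N n M.
Proof. split; [exact: Ext_zero_ext_vanish | exact: ext_vanish_Ext_zero]. Qed.

(** Extending the identity of [K] along [K -> Q] splits the presentation, so [M] is a retract of
    [Q]. *)
Lemma ext1_vanish_all_projective M :
  (forall N, ext1_vanish N M) -> projective M.
Proof.
move=> M_ext; have [K [Q [i [p [Q_proj ip]]]]] := cover_exists M.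
have [r ri] := M_ext K _ _ _ _ ip idfun.
exact: retract_projective (retraction_retract ip ri) Q_proj.
Qed.

(** A form of finite resolutions suited to induction along syzygies. The base case asks for an
    isomorphism with a member of [X], as [X] may not be closed under isomorphism. *)
Fixpoint resolved_by X n M : Prop :=
  if n is n'.+1 then
    exists K Q (i : {linear K -> Q}) (p : {linear Q -> M}),
      [/\ X Q, short_exact i p & resolved_by X n' K]
  else exists Q (f : {linear Q -> M}), [/\ X Q, injective f & surjective_lin f].

Lemma has_resolution_resolved_by X n M :
  has_resolution_of_length X M n -> resolved_by X n M.
Proof.
elim: n M => [|n IHn] M [r [rX r0]].
  exists (r 0%N), (res_aug r); split; [exact: rX | | exact: res_aug_surj].
  apply: raddf_inj => x /res_exact0[y <-].
  by rewrite (r0 1%N isT y) linear0.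
have [K [i [p [ip ipE]]]] := syzygy_exists r.
exists K, (r 0%N), i, (res_aug r); split=> //; first exact: rX.
apply: IHn; exists (shift_resolution ip ipE).
by split=> m mn /=; [apply: rX | apply: r0].
Qed.

Lemma zero_module_exists : exists M, zero_module M.
Proof.
have [Z [z [z_inj z0]]] := kernel_exists (idfun : {linear R^c^o -> R^c^o}).
by exists Z => x; apply: z_inj; rewrite linear0; apply/z0; exists x.
Qed.

Lemma resolved_by_has_resolution X n M :
  resolved_by X n M -> has_resolution_of_length X M n.
Proof.
elim: n M => [|n IHn] M.
  move=> [Q [f [XQ f_inj f_surj]]].
  (* The resolution with [Q] in degree zero and zeros above is the splice of [0 -> Z -> Q -> M -> 0]
     with the zero resolution of [Z]. *)
  have [Z Z0] := zero_module_exists.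
  have linZ L : exists g : {linear Z -> L}, forall x, g x = 0.
    by apply: linear_exists => a x y; rewrite scaler0 addr0.
  have [[z z0] [i i0]] := (linZ Z, linZ Q).
  have z_surj : surjective_lin z by move=> x; exists x; rewrite z0 (Z0 x).
  have z_exact : exact_at z z by move=> x; rewrite z0 (Z0 x); split=> // _; exists 0.
  have iQ : short_exact i f.
    split=> // [x y _|x]; first by rewrite (Z0 x) (Z0 y).
    split=> [|[y <-]]; last by rewrite i0 linear0.
    by rewrite -(linear0 f) => /f_inj->; exists 0; rewrite i0.
  pose rZ := @Resolution R Z (fun=> Z) (fun=> z) z z_surj z_exact (fun=> z_exact).
  by exists (splice_resolution rZ iQ); split=> -[|m].
move=> [K [Q [i [p [XQ ip /IHn[r [rX r0]]]]]]].
by exists (splice_resolution r ip); split=> -[|m] //; [apply: rX | apply: r0].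
Qed.

End Resolutions.

(** * Finitistic dimensions *)

Lemma eleastP (P : nat -> Prop) : efinite (eleast P) <-> exists n, P n.
Proof.
rewrite /efinite /eleast; case: pselect => [exP|nexP]; first by split.
by split=> // /nexP.
Qed.

Lemma eleast_least (P : nat -> Prop) n : P n -> enat_le_nat (eleast P) n.
Proof.
move=> Pn; rewrite /eleast; case: pselect => [exP /=|[]]; last by exists n.
by case: ex_minnP => m _; apply; apply/asboolP.
Qed.

Lemma eleast_le (P : nat -> Prop) n :
  enat_le_nat (eleast P) n -> exists2 m, (m <= n)%N & P m.
Proof.
rewrite /eleast; case: pselect => [exP /=|//].
by case: ex_minnP => m /asboolP Pm _ mn; exists m.
Qed.

Lemma esup_finiteP (T : Type) (Y : T -> Prop) (f : T -> enat) :
  efinite (esup Y f) <-> exists n, forall x, Y x -> enat_le_nat (f x) n.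
Proof. exact: eleastP. Qed.

Section FiniteDimension.
Variable R : pzRingType.
Implicit Types (K L M N Q : rmod R) (X Y A B : rmod R -> Prop).

Lemma projective_resolved_by0 M : resolved_by (@projective R) 0 M -> projective M.
Proof.
by move=> [Q [f [Q_proj f_inj f_surj]]];
  apply: retract_projective Q_proj; apply: retract_iso f_inj f_surj.
Qed.

(** Passing to syzygies reduces to length one, where the kernel [K] is itself projective:
    [Ext^1(M, K) = 0] splits the sequence, and [M] is projective. *)
Lemma resolved_by_projective_pred n M :
    (forall N, projective N -> ext_vanish N n M) ->
  resolved_by (@projective R) n.+1 M -> resolved_by (@projective R) n M.
Proof.
elim: n M => [|n IHn] M M_ext [K [Q [i [p [Q_proj ip K_res]]]]].
  have [r ri] := M_ext K (projective_resolved_by0 K_res) _ _ _ _ ip idfun.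
  exists M, idfun; split=> // [|x]; last by exists x.
  exact: retract_projective (retraction_retract ip ri) Q_proj.
exists K, Q, i, p; split=> //; apply: IHn => // N N_proj.
exact: ext_vanish_syzygy Q_proj ip (M_ext N N_proj).
Qed.

(** The length is lowered one at a time while it exceeds [n]. *)
Lemma resolved_by_projective_le n d M :
    (forall N, projective N -> forall j, (n <= j)%N -> ext_vanish N j M) ->
    resolved_by (@projective R) d M ->
  exists2 m, (m <= n)%N & resolved_by (@projective R) m M.
Proof.
move=> M_ext; elim: d => [|d IHd] M_res; first by exists 0%N.
have [|dn] := leqP d.+1 n; first by exists d.+1.
apply/IHd/resolved_by_projective_pred => // N N_proj; exact: M_ext.
Qed.

Lemma ext_vanish_resolved_by X N k n M :
    (forall Q, X Q -> forall j, (k <= j)%N -> ext_vanish N j Q) ->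
    resolved_by X n M ->
  forall j, (n + k <= j)%N -> ext_vanish N j M.
Proof.
move=> X_ext; elim: n M => [|n IHn] M.
  move=> [Q [f [XQ f_inj f_surj]]] j kj.
  exact: ext_vanish_retract (retract_iso f_inj f_surj) (X_ext Q XQ j kj).
(* Degree [0] is excluded by the bound. Passing from [K] to [M] costs one degree, which is why the
   length is added to [k]. *)
move=> [K [Q [i [p [XQ ip K_res]]]]] [|j] // nkj.
apply: ext_vanish_cokernel ip (IHn K K_res j nkj) (X_ext Q XQ _ _).
by rewrite (leq_trans _ nkj) // leq_addl.
Qed.

(** The strict bound on the degree of [Ext] becomes [k <= j] because [ext_vanish N j] stands for
    [Ext^(j+1)]. *)
Lemma rel_pd_class_finite X : efinite (rel_pd_class X X) -> exists k,
  forall M N, X M -> X N -> forall j, (k <= j)%N -> ext_vanish N j M.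
Proof.
move=> /esup_finiteP[k kP]; exists k => M N XM XN j kj.
have [m mk mP] := eleast_le (kP M XM).
by apply/Ext_zeroP/mP => //; rewrite ltnS (leq_trans mk).
Qed.

Lemma cotorsion_pair_projective A B Q :
  cotorsion_pair A B -> projective Q -> A Q.
Proof.
move=> [AP _] Q_proj; apply/AP => N _.
exact/Ext_zeroP/ext_vanish_projective.
Qed.

Lemma projective_cotorsion_pair :
  hereditary_complete_cotorsion_pair (@projective R) (fun=> True).
Proof.
split.
- split=> M; split=> //.
  + move=> M_proj N _; exact/Ext_zeroP/ext_vanish_projective.
  + move=> M_ext; apply: ext1_vanish_all_projective => N.
    exact/(@Ext_zeroP _ 0)/M_ext.
  + move=> _ N N_proj; exact/Ext_zeroP/ext_vanish_projective.
- move=> M; split.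
    by have [K [Q [i [p [Q_proj ip]]]]] := cover_exists M; exists K, Q, i, p.
  (* As every module is in the right class, the second sequence can be [0 -> M -> M -> 0 -> 0]. *)
  have [Z Z0] := zero_module_exists R.
  have [|z z0] := @linear_exists R M Z (fun=> 0).
    by move=> a x y; rewrite scaler0 addr0.
  exists M, Z, idfun, z; split=> //; first exact: zero_projective.
  split=> // x; last by exists 0; rewrite linear0 (Z0 x).
  by split=> _; [exists x | apply: z0].
- move=> [|i] M N // _ M_proj _.
  exact/Ext_zeroP/ext_vanish_projective.
Qed.

Lemma rel_pd_projective : efinite (rel_pd_class (@projective R) (@projective R)).
Proof.
apply/esup_finiteP; exists 0%N => M M_proj; apply: eleast_least => N _ [|j] // _.
exact/Ext_zeroP/ext_vanish_projective.
Qed.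

Lemma sub_resdim_finite X X' Y :
    (forall M, X M -> X' M) ->
  efinite (resdim_class X Y) -> efinite (resdim_class X' Y).
Proof.
move=> XX' /esup_finiteP[n nP]; apply/esup_finiteP; exists n => M YM.
have [m mn [r [rX r0]]] := eleast_le (nP M YM).
have: enat_le_nat (resdim X' M) m.
  by apply: eleast_least; exists r; split=> // i im; apply/XX'/rX.
by case: (resdim X' M) => //= l lm; apply: leq_trans lm mn.
Qed.

(** Each [M] in [Y] has a projective resolution of some length [d], with no uniform bound; the
    vanishing of [Ext] from [M] to projectives cuts it down to [n + k], which does not depend on
    [M]. *)
Lemma resdim_finite_pd A B Y :
    (forall M, Y M -> fin_pd M) -> cotorsion_pair A B ->
    efinite (rel_pd_class A A) -> efinite (resdim_class A Y) ->
  efinite (esup Y (@pd R)).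
Proof.
move=> Y_fin AB /rel_pd_class_finite[k kP] /esup_finiteP[n nP].
apply/esup_finiteP; exists (n + k)%N => M YM.
have /eleastP[d /has_resolution_resolved_by M_proj] := Y_fin M YM.
have [m mn /has_resolution_resolved_by M_res] := eleast_le (nP M YM).
have [N N_proj j mkj||l lmk M_l] := @resolved_by_projective_le (m + k) d M.
- apply: ext_vanish_resolved_by M_res j mkj => Q AQ.
  exact/kP/(cotorsion_pair_projective AB).
- exact: M_proj.
have := eleast_least (resolved_by_has_resolution M_l).
rewrite -/(resdim _ M) -/(pd M); case: (pd M) => //= e el.
by apply: leq_trans el (leq_trans lmk _); rewrite leq_add2r.
Qed.

(** Both equivalences are instances of this one, as all that matters about [Y] is that its members
    have finite projective dimension. *)
Lemma finitistic_dimension_tfae Y : (forall M, Y M -> fin_pd M) ->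
  [<-> efinite (esup Y (@pd R));
       exists A B : rmod R -> Prop,
         [/\ hereditary_complete_cotorsion_pair A B,
             efinite (rel_pd_class A A) &
             efinite (resdim_class A Y)];
       forall A B : rmod R -> Prop,
         hereditary_complete_cotorsion_pair A B ->
         efinite (rel_pd_class A A) ->
         efinite (resdim_class A Y)].
Proof.
move=> Y_fin; tfae.
- move=> Y_pd; exists (@projective R), (fun=> True); split=> //.
    exact: projective_cotorsion_pair.
  exact: rel_pd_projective.
(* The given pair bounds the projective dimensions on [Y], and projective resolutions are
   resolutions by [A'] for any other pair. *)
- move=> [A [B [[AB _ _] A_pd Y_res]]] A' B' [AB' _ _] _.
  apply: (sub_resdim_finite (X := @projective R)).
    by move=> M; apply: cotorsion_pair_projective AB'.
  exact: resdim_finite_pd AB A_pd Y_res.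
(* For the pair with the projectives on the left, [resdim_class] is by definition the supremum of
   [pd] over [Y]. *)
- by move=> /(_ _ _ projective_cotorsion_pair rel_pd_projective).
Qed.

End FiniteDimension.

Theorem corollary4p4 (R : pzRingType) :
  [<-> efinite (Findim R);
       exists A B : rmod R -> Prop,
         [/\ hereditary_complete_cotorsion_pair A B,
             efinite (rel_pd_class A A) &
             efinite (resdim_class A (@fin_pd R))];
       forall A B : rmod R -> Prop,
         hereditary_complete_cotorsion_pair A B ->
         efinite (rel_pd_class A A) ->
         efinite (resdim_class A (@fin_pd R))]
  /\
  [<-> efinite (findim R);
       exists A B : rmod R -> Prop,
         [/\ hereditary_complete_cotorsion_pair A B,
             efinite (rel_pd_class A A) &
             efinite (resdim_class A (@fin_pd_small R))];
       forall A B : rmod R -> Prop,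
         hereditary_complete_cotorsion_pair A B ->
         efinite (rel_pd_class A A) ->
         efinite (resdim_class A (@fin_pd_small R))].
Proof.
by split; apply: finitistic_dimension_tfae => // M [].
Qed.
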